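(* Let $M$ be an indecomposable module of Dynkin type $\mathbb{A}_n$ and let $\mathcal{L}$ be the submodule lattice of $M$. Then $$\sum_{L\in\mathcal{L}}(-1)^{h(L)}=\begin{cases}\pm1&\text{if } |\mathcal{L}| \text{ is odd};\\ 0&\text{if } |\mathcal{L}|\text{ is even},\end{cases}$$ where $h(L)=\dim L=\sum_{j\in Q_0}\dim L_j$ is the total dimension of the submodule $L$.
   Context: A module of Dynkin type $\mathbb{A}_n$ is a finite-dimensional representation, over an algebraically closed field, of a quiver $Q$ whose underlying graph is the Dynkin diagram $\mathbb{A}_n$ (a path on $n$ vertices), with arbitrary orientation of the edges. $Q_0$ is the vertex set of $Q$ and $L_j$ is the vector space of the representation $L$ at vertex $j$. *)

(* Defs.v *)
From HB Require Import structures.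
From mathcomp Require Import all_boot all_order all_algebra.

Set Implicit Arguments.
Unset Strict Implicit.
Unset Printing Implicit Defensive.

Import GRing.Theory.
Local Open Scope ring_scope.

Record quiver := Quiver {
  vertex : finType;
  arrow : finType;
  source : arrow -> vertex;
  target : arrow -> vertex
}.

(* [f] numbers the vertices 0, ..., n-1 and [g] numbers the arrows
   0, ..., n-2, so that arrow number i joins vertices i and i+1, in either
   direction. *)
Definition of_type_A (n : nat) (Q : quiver) : Prop :=
  exists (f : vertex Q -> 'I_n) (g : arrow Q -> 'I_n.-1),
    [/\ bijective f, bijective g &
      forall a : arrow Q,
        (f (source a) = g a :> nat /\ f (target a) = (g a).+1 :> nat) \/
        (f (target a) = g a :> nat /\ f (source a) = (g a).+1 :> nat)].

Record representation (k : fieldType) (Q : quiver) := Representation {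
  rep_space :> vertex Q -> vectType k;
  rep_map : forall a : arrow Q,
    'Hom(rep_space (source a), rep_space (target a))
}.

Section Submodules.
Variables (k : fieldType) (Q : quiver) (M : representation k Q).

Local Notation subspaces := {dffun forall j : vertex Q, {vspace M j}}.

Definition stable (U : subspaces) : bool :=
  [forall a : arrow Q, (rep_map M a @: U (source a) <= U (target a))%VS].

Record submodule := Submodule {
  submodule_val :> subspaces;
  submodule_stable : stable submodule_val
}.

HB.instance Definition _ := [isSub for submodule_val].
HB.instance Definition _ := [Choice of submodule by <:].

Definition height (L : submodule) : nat := (\sum_(j : vertex Q) \dim (L j))%N.

Definition indecomposable : Prop :=
  (exists j : vertex Q, {:M j}%VS != 0%VS) /\
  forall U W : submodule,
    (forall j : vertex Q, (U j + W j)%VS = fullv /\ (U j :&: W j)%VS = 0%VS) ->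
    (forall j : vertex Q, U j = 0%VS) \/ (forall j : vertex Q, W j = 0%VS).

End Submodules.

(* Main.v *)
(** A nonzero vertex x, taken extremal along the path, carries a flag F such that
    every splitting of M_x into a line [v] and a hyperplane H adapted to F (v in
    F_{i+1}, F_i contained in H) extends to a splitting of M whose first summand
    has dimension at most 1 at each vertex; the flag is transported along the
    path by images and preimages. Taking v in the first nonzero step of F,
    indecomposability makes this thin summand all of M. The submodules of a thin
    module are the subsets of its support closed under the nonzero arrows, and a
    transfer argument along the path bounds their signed count by 1 in absolute
    value. Since the signed count has the parity of the lattice, this suffices. *)

Require Import Defs.
From HB Require Import structures.
From mathcomp Require Import all_boot all_order all_algebra.
From mathcomp Require Import zify.

Set Implicit Arguments.
Unset Strict Implicit.
Unset Printing Implicit Defensive.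

Import GRing.Theory.
Local Open Scope ring_scope.

(** * Hyperplanes complementary to a line *)

Section Hyperplanes.
Variable k : fieldType.
Implicit Types V W : vectType k.

Definition hyperplane_off V (v : V) (H : {vspace V}) : bool :=
  (v \notin H) && (<[v]> + H == fullv)%VS.

Lemma capv_line_notin V (v : V) (H : {vspace V}) :
  v \notin H -> (<[v]> :&: H = 0)%VS.
Proof.
move=> vH; apply/eqP; rewrite -subv0; apply/subvP=> u /memv_capP[/vlineP[c ->]].
by rewrite !rpredZeq (negPf vH) orbF => ->.
Qed.

Lemma hyperplane_off_extend V (v : V) (A : {vspace V}) :
  v \notin A -> exists2 H, (A <= H)%VS & hyperplane_off v H.
Proof.
move=> vA; exists (A + (<[v]> + A)^C)%VS; first exact: addvSl.
apply/andP; split; last by rewrite addvA addv_complf.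
apply: contra vA => /memv_addP[a aA [c cC vE]].
suff c0 : c = 0 by rewrite vE c0 addr0.
apply/eqP; rewrite -memv0 -(capv_compl (<[v]> + A)) memv_cap cC andbT.
have -> : c = v - a by rewrite vE addrAC subrr add0r.
by rewrite memv_add ?memv_line ?memvN.
Qed.

(** If [f u = c *: f v + h] with [h] in [H], then [u - c *: v] lies in the preimage of [H]. *)
Lemma hyperplane_off_preim V W (f : 'Hom(V, W)) v (H : {vspace W}) :
  hyperplane_off (f v) H -> hyperplane_off v (f @^-1: H)%VS.
Proof.
case/andP=> fvH /eqP fullH; apply/andP; split; first by rewrite -memv_preim.
rewrite eqEsubv subvf; apply/subvP=> u _.
have /memv_addP[_ /vlineP[c ->] [h hH fuE]] : f u \in (<[f v]> + H)%VS.
  by rewrite fullH memvf.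
rewrite -[u](subrKC (c *: v)) memv_add ?memvZ ?memv_line//.
by rewrite -memv_preim linearB linearZ /= fuE addrAC subrr add0r.
Qed.

End Hyperplanes.

(** * Indecomposable representations of a path are thin *)

Section Thinness.
Local Open Scope nat_scope.
Variables (k : fieldType) (Q : quiver) (M : representation k Q).
(** [r] is the position along the path. The ends of an arrow have consecutive positions, so their
    sum identifies the edge whatever its orientation, and [r_arrow_inj] excludes parallel arrows. *)
Variable r : vertex Q -> nat.
Hypothesis r_inj : injective r.
Hypothesis r_arrow : forall a : arrow Q,
  r (source a) = (r (target a)).+1 \/ r (target a) = (r (source a)).+1.
Hypothesis r_arrow_inj : injective (fun a : arrow Q => r (source a) + r (target a))%N.

Definition stable_at (U : forall j, {vspace M j}) (a : arrow Q) : bool :=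
  (rep_map M a @: U (source a) <= U (target a))%VS.

Definition thin_split j (A B : {vspace M j}) : bool :=
  [&& (A + B == fullv)%VS, (A :&: B == 0)%VS & \dim A <= 1].

(** A splitting of the restriction of [M] to the vertices up to [x], with prescribed values at [x].
    The families are total functions, left unconstrained beyond [x]. *)
Definition splits_below x (v : M x) (H : {vspace M x}) : Prop :=
  exists U T : forall j, {vspace M j},
    [/\ U x = <[v]>%VS, T x = H, forall j, r j <= r x -> thin_split (U j) (T j) &
      forall a, r (source a) <= r x -> r (target a) <= r x ->
        stable_at U a && stable_at T a].

Lemma thin_split_hyperplane j (v : M j) (H : {vspace M j}) :
  hyperplane_off v H -> thin_split <[v]>%VS H.
Proof.
case/andP=> vH /eqP fullH; rewrite /thin_split fullH capv_line_notin// !eqxx.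
by rewrite dim_vline; case: (v != 0%R).
Qed.

(** [dfwith] changes a family only at [x], so a splitting strictly below [x] extends to [x] once the
    arrows with higher end [x] are checked. *)
Lemma splits_below_dfwith x (v : M x) (H : {vspace M x})
    (U T : forall j, {vspace M j}) :
  hyperplane_off v H ->
  (forall j, r j < r x -> thin_split (U j) (T j)) ->
  (forall a, r (source a) < r x -> r (target a) < r x ->
    stable_at U a && stable_at T a) ->
  (forall a, maxn (r (source a)) (r (target a)) = r x ->
    stable_at (dfwith U <[v]>%VS) a && stable_at (dfwith T H) a) ->
  splits_below v H.
Proof.
move=> vH UT stabUT stabx; exists (dfwith U <[v]>%VS), (dfwith T H).
split; rewrite ?dfwith_in//.
  move=> j; have [<-|xj] := eqVneq x j; first by
    rewrite !dfwith_in thin_split_hyperplane.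
  rewrite leq_eqVlt (inj_eq r_inj) eq_sym (negPf xj) /= => /UT.
  by rewrite !dfwith_out.
move=> a sx tx.
have [/stabx//|max_x] :=
    eqVneq (maxn (r (source a)) (r (target a))) (r x).
have {}sx : r (source a) < r x by lia.
have {}tx : r (target a) < r x by lia.
have xs : x != source a by apply: contraTneq sx => <-; rewrite ltnn.
have xt : x != target a by apply: contraTneq tx => <-; rewrite ltnn.
by rewrite /stable_at !dfwith_out//; apply: stabUT.
Qed.

Lemma splits_below_zero x (v : M x) (H : {vspace M x}) :
  hyperplane_off v H ->
  (forall a, maxn (r (source a)) (r (target a)) = r x ->
    stable_at (dfwith (fun j => 0%VS : {vspace M j}) <[v]>%VS) a &&
    stable_at (dfwith (fun j => fullv : {vspace M j}) H) a) ->
  splits_below v H.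
Proof.
move=> vH stabx; apply: splits_below_dfwith stabx => // [j _|a _ _].
  by rewrite /thin_split add0v cap0v dimv0 !eqxx.
by rewrite /stable_at limg0 sub0v subvf.
Qed.

(** The higher end of an arrow fixes the position of the lower one, hence the sum of the two. *)
Lemma arrow_max_inj a b :
  maxn (r (source a)) (r (target a)) = maxn (r (source b)) (r (target b)) ->
  a = b.
Proof.
move=> eq_max; apply: r_arrow_inj => /=.
by have := r_arrow a; have := r_arrow b; lia.
Qed.

Definition splitting_flag x (F : nat -> {vspace M x}) (m : nat) : Prop :=
  [/\ F 0 = 0%VS, F m = fullv &
    forall i v H, i < m -> v \in F i.+1 -> (F i <= H)%VS ->
      hyperplane_off v H -> splits_below v H].

(** The flag is pushed forward along [f], and a last step from the image of [f] to the whole space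
    is appended. For [v = f u], a splitting with values [u] and the preimage of [H] at the source
    extends by [v] and [H]. *)
Lemma splitting_flag_target a F m :
  r (target a) = (r (source a)).+1 -> splitting_flag (x := source a) F m ->
  exists F' m', splitting_flag (x := target a) F' m'.
Proof.
move=> ra [F0 Fm splitF]; set f := rep_map M a.
exists (fun i => if i <= m then (f @: F i)%VS else fullv), m.+1.
split=> [||i v H]; [by rewrite F0 limg0 | by rewrite ltnn |].
have st : target a != source a by apply: contra_eqN ra => /eqP->; lia.
rewrite ltnS => le_im; rewrite le_im; have [im|mi] := ltnP i m; last first.
  have -> : i = m by lia.
  (* In the last step [H] contains the image of [f], so the second summand can be everything below
     and the line starts at the new vertex. *)
  rewrite Fm => _ fH vH; apply: splits_below_zero => // b b_max.
  have -> : b = a by apply: arrow_max_inj; lia.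
  by rewrite /stable_at !dfwith_in !dfwith_out// limg0 sub0v.
move=> /memv_imgP[u uF ->] FH vH.
have [|U [T [Us Ts UT stabUT]]] := splitF i u (f @^-1: H)%VS im uF _
  (hyperplane_off_preim vH).
  by apply/subvP=> w wF; rewrite -memv_preim (subvP FH)// memv_img.
apply: (splits_below_dfwith (U := U) (T := T)) => // [j jt|b sb tb|b b_max].
- by apply: UT; lia.
- by apply: stabUT; lia.
have -> : b = a by apply: arrow_max_inj; lia.
rewrite /stable_at !dfwith_in !dfwith_out// Us Ts limg_line subvv.
by apply/subvP=> _ /memv_imgP[w wH ->]; rewrite memv_preim.
Qed.

(** Dually, the flag is pulled back along [f], and a first step from 0 to the kernel of [f] is
    prepended. *)
Lemma splitting_flag_source a F m :
  r (source a) = (r (target a)).+1 -> splitting_flag (x := target a) F m ->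
  exists F' m', splitting_flag (x := source a) F' m'.
Proof.
move=> ra [F0 Fm splitF]; set f := rep_map M a.
exists (fun i => if i is i'.+1 then (f @^-1: F i')%VS else 0%VS), m.+1.
split=> // [|i v H].
  apply/eqP; rewrite eqEsubv subvf; apply/subvP=> u _.
  by rewrite -memv_preim Fm memvf.
have st : source a != target a by apply: contra_eqN ra => /eqP->; lia.
case: i => [_|i im].
  (* In the first step [f] kills [v], so the first summand can be zero below. *)
  rewrite F0 lpreim0 memv_ker => /eqP fv0 _ vH.
  apply: splits_below_zero => // b b_max.
  have -> : b = a by apply: arrow_max_inj; lia.
  by rewrite /stable_at !dfwith_in !dfwith_out// limg_line fv0 subvf subvv.
rewrite -memv_preim => fvF FH vH.
(* If [f v = u + f w] with [u] in [F i] and [w] in [H], then [v - w] lies in the preimage of [F i],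
   hence in [H], and so would [v]. The resulting [H'] must contain [F i] to use the flag, and
   [f @: H] for stability along [a]. *)
have /hyperplane_off_extend[H'] : f v \notin (F i + f @: H)%VS.
  case/andP: vH => + _; apply: contra => /memv_addP[u uF [_ /memv_imgP[w wH ->] fvE]].
  rewrite -[v](subrK w) memvD// (subvP FH)// -memv_preim linearB /= fvE.
  by rewrite addrK.
rewrite subv_add => /andP[FH' fH'] fvH'.
have [U [T [Ut Tt UT stabUT]]] := splitF i (f v) H' im fvF FH' fvH'.
apply: (splits_below_dfwith (U := U) (T := T)) => // [j jt|b sb tb|b b_max].
- by apply: UT; lia.
- by apply: stabUT; lia.
have -> : b = a by apply: arrow_max_inj; lia.
by rewrite /stable_at !dfwith_in !dfwith_out// Ut Tt limg_line subvv.
Qed.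

Lemma splitting_flag_exists x : exists F m, splitting_flag (x := x) F m.
Proof.
have [n] := ubnP (r x); elim: n => // n IHn in x *; rewrite ltnS => xn.
have [a /eqP a_max|no_arrow] :=
  pickP [pred a | maxn (r (source a)) (r (target a)) == r x].
  have [ra|ra] := r_arrow a.
    have <- : source a = x by apply: r_inj; lia.
    by have [|F [m]] := IHn (target a); [lia | apply: splitting_flag_source].
  have <- : target a = x by apply: r_inj; lia.
  by have [|F [m]] := IHn (source a); [lia | apply: splitting_flag_target].
(* No arrow leads from [x] to a lower vertex, so the flag with the single step from 0 to the whole
   space works. *)
exists (fun i => if i is 0 then 0%VS else fullv), 1%N; split=> // i v H _ _ _ vH.
by apply: splits_below_zero => // a a_max; have := no_arrow a; rewrite /= a_max eqxx.
Qed.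

Lemma indecomposable_thin :
  indecomposable M -> forall j, \dim {:M j} <= 1.
Proof.
move=> [[x0 nz_x0] indec].
(* [M] vanishes above the highest vertex [x] of its support, so a splitting up to [x] is a splitting
   of [M]. *)
have [x nz_x x_max] := @arg_maxnP _ x0 (fun j => {:M j}%VS != 0%VS) r nz_x0.
have above_x j : ~~ (r j <= r x) -> {:M j}%VS = 0%VS.
  by move=> jx; apply/eqP; apply: contraNT jx => /x_max.
have [F [m [F0 Fm splitF]]] := splitting_flag_exists x.
have : exists i, F i != 0%VS by exists m; rewrite Fm.
case/ex_minnP=> [[|i]]; first by rewrite F0 eqxx.
(* Minimality gives [F i = 0], so any complement [H] of the line through [v] is admissible. *)
move=> nzF F_min; set v := vpick (F i.+1).
have Fi0 : F i = 0%VS by apply/eqP; apply: contraT => /F_min; rewrite ltnn.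
have nz_v : v != 0%R by rewrite vpick0.
have im : i < m by apply: F_min; rewrite Fm.
have [|H _ vH] := @hyperplane_off_extend _ _ v 0%VS; first by rewrite memv0.
have [|U [T [Ux _ UT stabUT]]] := splitF i v H im (memv_pick _) _ vH.
  by rewrite Fi0 sub0v.
have split_all j : thin_split (U j) (T j).
  have [/UT//|/above_x M0] := boolP (r j <= r x).
  have zero (A : {vspace M j}) : A = 0%VS by apply/eqP; rewrite -subv0 -M0 subvf.
  by rewrite /thin_split M0 (zero (U j)) (zero (T j)) add0v cap0v dimv0 !eqxx.
have stab_all a : stable_at U a && stable_at T a.
  have [sx|/above_x M0] := boolP (r (source a) <= r x); last first.
    have zero (A : {vspace M (source a)}) : A = 0%VS.
      by apply/eqP; rewrite -subv0 -M0 subvf.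
    by rewrite /stable_at (zero (U _)) (zero (T _)) limg0 !sub0v.
  have [tx|/above_x M0] := boolP (r (target a) <= r x); first exact: stabUT.
  have zero (A : {vspace M (target a)}) : A = 0%VS.
    by apply/eqP; rewrite -subv0 -M0 subvf.
  by rewrite /stable_at !(zero (_ @: _)%VS) !sub0v.
have mk (A : forall j, {vspace M j}) : (forall a, stable_at A a) ->
    {L : submodule M | forall j, L j = A j}.
  move=> stabA.
  have stA : stable [ffun j => A j : {vspace M j}].
    by apply/forallP=> a; rewrite !ffunE; apply: stabA.
  by exists (Submodule stA) => j; rewrite /= ffunE.
have [LU LUE] := mk U (fun a => proj1 (andP (stab_all a))).
have [LT LTE] := mk T (fun a => proj2 (andP (stab_all a))).
have [|LU0|LT0] := indec LU LT.
- by move=> j; rewrite LUE LTE; case/and3P: (split_all j) => /eqP-> /eqP->.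
- by move: (LU0 x); rewrite LUE Ux => /eqP; rewrite -dimv_eq0 dim_vline nz_v.
move=> j; by case/and3P: (split_all j) => /eqP<- _; rewrite -(LTE j) LT0 addv0.
Qed.

End Thinness.

(** * Signed counts of closed vertex sets along a path *)

Section ClosedSets.
Variables (Q : quiver) (r : vertex Q -> nat).
Hypothesis r_inj : injective r.
Hypothesis r_arrow : forall a : arrow Q,
  r (source a) = (r (target a)).+1 \/ r (target a) = (r (source a)).+1.
Hypothesis r_arrow_inj : injective (fun a : arrow Q => r (source a) + r (target a))%N.
Variable C : pred (arrow Q).
Implicit Types (P S : {set vertex Q}) (Z : pred {set vertex Q}).

Definition closed_in P S : bool :=
  [forall a, [&& C a, source a \in P, target a \in P & source a \in S] ==>
    (target a \in S)].

Definition signed_sum P Z : int :=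
  \sum_(S : {set vertex Q} | [&& S \subset P, closed_in P S & Z S]) (-1) ^+ #|S|.

Lemma signed_sum_split P x : signed_sum P predT =
  signed_sum P (fun S => x \in S) + signed_sum P (fun S => x \notin S).
Proof.
rewrite /signed_sum (bigID (fun S : {set vertex Q} => x \in S)) /=.
by congr (_ + _); apply: eq_bigl => S; rewrite andbT -!andbA.
Qed.

(** [Z] carries what the arrows between [x] and the rest demand of [S] once it is decided that [x]
    is left out. *)
Lemma signed_sum_out P x Z : x \in P ->
  (forall S, S \subset P :\ x -> closed_in P S = closed_in (P :\ x) S && Z S) ->
  signed_sum P (fun S => x \notin S) = signed_sum (P :\ x) Z.
Proof.
move=> xP ZP; apply: eq_bigl => S.
have [SPx|] := boolP (S \subset P :\ x).
  by have := SPx; rewrite ZP// subsetD1 => /andP[-> ->]; rewrite andbT.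
by rewrite subsetD1 negb_and => /orP[/negPf->|/negPf->]; rewrite ?andbF.
Qed.

(** Deleting [x] is a bijection that lowers the cardinality by one, which accounts for the sign. *)
Lemma signed_sum_in P x Z : x \in P ->
  (forall S, S \subset P :\ x -> closed_in P (x |: S) = closed_in (P :\ x) S && Z S) ->
  signed_sum P (fun S => x \in S) = - signed_sum (P :\ x) Z.
Proof.
move=> xP ZP; rewrite /signed_sum -sumrN.
rewrite (reindex_onto (fun S => x |: S) (fun S => S :\ x)) /=; last first.
  by move=> S /and3P[_ _ xS]; rewrite setD1K.
have xPS S : (x |: S \subset P) && ((x |: S) :\ x == S) = (S \subset P :\ x).
  rewrite subUset sub1set xP subsetD1; case: (boolP (x \in S)) => xS.
    rewrite andbF; apply: contraTF xS => /andP[_ /eqP<-].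
    by rewrite !inE eqxx.
  by rewrite setU1K// eqxx.
apply: eq_big => [S|S].
  rewrite setU11 andbT andbAC xPS.
  by have [SPx|] := boolP (S \subset P :\ x); rewrite // ZP.
rewrite setU11 andbT andbAC xPS subsetD1 => /andP[/andP[_ xS] _].
by rewrite cardsU1 xS add1n exprS mulN1r.
Qed.

(* With [p] and [q] the signed sums over [x \notin S] and [x \in S], passing to
   the next vertex of the path replaces [(p, q, p + q)] by
   [(p + q, - (p + q), 0)], [(p + q, - q, p)] or [(p, - (p + q), - q)]. *)
Lemma signed_sum_bounded P :
  (-1 <= signed_sum P predT <= 1) /\
  (forall x, x \in P -> {in P, forall y, (r y <= r x)%N} ->
    (-1 <= signed_sum P (fun S => x \in S) <= 1) /\
    (-1 <= signed_sum P (fun S => x \notin S) <= 1)).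
Proof.
have [n] := ubnP #|P|; elim: n => // n IHn in P *; rewrite ltnS => Pn.
suff bound x : x \in P -> {in P, forall y, (r y <= r x)%N} ->
    (-1 <= signed_sum P predT <= 1) /\
    (-1 <= signed_sum P (fun S => x \in S) <= 1) /\
    (-1 <= signed_sum P (fun S => x \notin S) <= 1).
  split=> [|x xP x_max]; last by have [] := bound x xP x_max.
  have [->|[x0 x0P]] := set_0Vmem P; last first.
    by have [x xP x_max] := arg_maxnP r x0P; have [] := bound x xP x_max.
  rewrite /signed_sum (big_pred1 set0) ?cards0// => S; rewrite subset0 andbT.
  have [->|nS] := eqVneq S set0; last by rewrite /= (negPf nS).
  have -> : closed_in set0 set0 by apply/forallP=> a; rewrite !inE !andbF.
  by rewrite /= eqxx.
move=> xP x_max; set P' := P :\ x.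
have [|boundT boundZ] := IHn P'; first by move: Pn; rewrite (cardsD1 x) xP.
have xP' : x \notin P' by rewrite !inE eqxx.
have no_loop (a : arrow Q) : source a != target a.
  by apply/eqP=> st; have := r_arrow a; rewrite st; lia.
have below y : y \in P' -> (r y < r x)%N.
  by rewrite !inE ltn_neqAle (inj_eq r_inj) => /andP[-> /x_max].
have Px y : (y \in P) = (y == x) || (y \in P').
  by rewrite !inE; case: eqVneq => [->|].
have splitT := signed_sum_split P x.
pose link (a : arrow Q) := C a && ((source a == x) && (target a \in P') ||
                       (target a == x) && (source a \in P')).
(* [S'] is [S] without [x]; this form covers both [S = S'] and [S = x |: S']. *)
have closedE S S' : S' \subset P' -> {in P', S =i S'} ->
    closed_in P S = closed_in P' S' &&
      [forall a, link a && (source a \in S) ==> (target a \in S)].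
  move=> SP' SS'; apply/forallP/andP=> [clS|[/forallP clS' /forallP cl_link] a].
    split; apply/forallP=> a; apply/implyP.
      case/and4P=> Ca sP tP sS; have := clS a.
      by rewrite Ca !Px sP tP !orbT SS'// sS SS'.
    case/andP=> /andP[Ca la] sS; have := clS a; rewrite Ca sS !Px.
    by case/orP: la => /andP[-> ->]; rewrite !orbT.
  apply/implyP; rewrite !Px => /and4P[Ca sP tP sS].
  have [la|not_link] := boolP (link a).
    by have := cl_link a; rewrite la sS.
  have [sP' tP'] : source a \in P' /\ target a \in P'.
    move: not_link (no_loop a); rewrite /link Ca /=.
    by case/orP: sP => [/eqP->|->]; case/orP: tP => [/eqP->|->]; rewrite ?eqxx ?orbT.
  by have := clS' a; rewrite Ca sP' tP' -!SS'// sS.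
have outE Z : (forall S, S \subset P' ->
      [forall a, link a && (source a \in S) ==> (target a \in S)] = Z S) ->
    signed_sum P (fun S => x \notin S) = signed_sum P' Z.
  move=> ZE; apply: signed_sum_out => // S SP; rewrite -ZE//; exact: closedE.
have memE Z : (forall S, S \subset P' ->
      [forall a, link a && (source a \in x |: S) ==> (target a \in x |: S)] = Z S) ->
    signed_sum P (fun S => x \in S) = - signed_sum P' Z.
  move=> ZE; apply: signed_sum_in => // S SP; rewrite -ZE//; apply: closedE => // y.
  by rewrite !inE => /andP[/negPf->].
have [a linka|no_link] := pickP link; last first.
  (* With no link, the choice of [x] is independent of the rest and the two halves cancel. *)
  have free (A B : pred (arrow Q)) : [forall a, link a && A a ==> B a] = true.
    by apply/forallP=> a; rewrite no_link.
  rewrite splitT (outE predT (fun _ _ => free _ _)) (memE predT (fun _ _ => free _ _)).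
  by lia.
have link_only b : link b -> b = a.
  move=> linkb; apply: r_arrow_inj => /=; have := r_arrow a; have := r_arrow b.
  case/andP: linka => _ /orP[]/andP[/eqP-> /below];
    by case/andP: linkb => _ /orP[]/andP[/eqP-> /below]; lia.
have linkE (S : {set vertex Q}) :
    [forall b, link b && (source b \in S) ==> (target b \in S)] =
    ((source a \in S) ==> (target a \in S)).
  apply/forallP/idP=> [/(_ a)|sat b]; first by rewrite linka.
  by apply/implyP=> /andP[/link_only-> ]; apply/implyP.
(* The linked neighbour is one position below [x], hence highest in [P'], so the refined bounds of
   the induction hypothesis apply to it. *)
have top y : y \in P' -> r x = (r y).+1 -> {in P', forall z, (r z <= r y)%N}.
  by move=> yP rxy z /below; rewrite rxy ltnS.
(* First the arrow leaves [x]: taking [x] forces its neighbour, and omitting [x] forces nothing. *)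
case/andP: (linka) => _ /orP[]/andP[/eqP ax yP'].
  have [|bin bout] := boundZ (target a) yP'.
    by apply: top => //; have := below _ yP'; have := r_arrow a; rewrite ax; lia.
  have out_a : signed_sum P (fun S => x \notin S) = signed_sum P' predT.
    apply: outE => S; rewrite linkE ax subsetD1 => /andP[_ /negPf->//].
  have in_a : signed_sum P (fun S => x \in S) =
      - signed_sum P' (fun S => target a \in S).
    apply: memE => S _; rewrite linkE ax setU11 in_setU1.
    by rewrite [target a == x]eq_sym -ax (negPf (no_loop a)).
  have splitT' := signed_sum_split P' (target a).
  by rewrite splitT out_a in_a; lia.
(* Now the arrow enters [x]: omitting [x] forbids its neighbour, and taking [x] forces nothing. *)
have [|bin bout] := boundZ (source a) yP'.
  by apply: top => //; have := below _ yP'; have := r_arrow a; rewrite ax; lia.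
have out_a : signed_sum P (fun S => x \notin S) =
    signed_sum P' (fun S => source a \notin S).
  apply: outE => S; rewrite linkE ax subsetD1 => /andP[_ /negPf->].
  by rewrite implybF.
have in_a : signed_sum P (fun S => x \in S) = - signed_sum P' predT.
  by apply: memE => S _; rewrite linkE ax setU11 implybT.
have splitT' := signed_sum_split P' (source a).
by rewrite splitT out_a in_a; lia.
Qed.
End ClosedSets.

(** * The submodule lattice of a thin representation *)

Section ThinLattice.
Variables (k : fieldType) (Q : quiver) (M : representation k Q).
Hypothesis thin : forall j, (\dim {:M j} <= 1)%N.

Definition support : {set vertex Q} := [set j | {:M j}%VS != 0%VS].

Definition spaces_on (S : {set vertex Q}) :
    {dffun forall j : vertex Q, {vspace M j}} :=
  [ffun j => if j \in S then fullv else 0%VS].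

(** [insub] drops the unstable families. Sets are taken inside the support because off it [fullv]
    and 0 coincide, which would cause repetitions. *)
Definition submodules : seq (submodule M) :=
  pmap insub (map spaces_on (enum (powerset support))).

Lemma thin_subspace j (A : {vspace M j}) : A != 0%VS -> A = fullv.
Proof.
rewrite -dimv_eq0 -lt0n => A_gt0; apply/eqP.
by rewrite eqEdim subvf (leq_trans (thin j)).
Qed.

Lemma dim_spaces_on (S : {set vertex Q}) j : S \subset support ->
  \dim (spaces_on S j) = (j \in S).
Proof.
rewrite ffunE; have [jS /subsetP/(_ j jS)|_ _] := boolP (j \in S); last exact: dimv0.
by rewrite inE -dimv_eq0; have := thin j; case: (\dim _) => [|[]].
Qed.

Lemma spaces_on_inj : {in powerset support &, injective spaces_on}.
Proof.
move=> S S'; rewrite !inE => SP SP' eqS; apply/setP=> j.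
by have := dim_spaces_on j SP; rewrite eqS dim_spaces_on//; do 2!case: (j \in _).
Qed.

Lemma spaces_on_support (A : {dffun forall j : vertex Q, {vspace M j}}) :
  A = spaces_on [set j | A j != 0%VS].
Proof.
apply/ffunP=> j; rewrite ffunE inE.
by case: eqVneq => // /thin_subspace.
Qed.

Lemma submodulesP : Finite.axiom submodules.
Proof.
move=> L; rewrite count_uniq_mem; last first.
  rewrite pmap_sub_uniq// map_inj_in_uniq ?enum_uniq// => S S'.
  by rewrite !mem_enum; apply: spaces_on_inj.
rewrite mem_pmap_sub; apply/eqP; rewrite eqb1; apply/mapP.
exists [set j | L j != 0%VS]; last exact: spaces_on_support.
rewrite mem_enum !inE; apply/subsetP=> j; rewrite !inE; apply: contra => /eqP M0.
by rewrite -subv0 -M0 subvf.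
Qed.

(** Only an arrow from [S] to its complement can obstruct stability, and it does so exactly when its
    map is nonzero. Such a map ends in the support, so [closed_in] sees the arrow. *)
Lemma stable_spaces_on (S : {set vertex Q}) : S \subset support ->
  stable (spaces_on S) = closed_in (fun a => rep_map M a @: fullv != 0)%VS support S.
Proof.
move=> SP; apply: eq_forallb => a; rewrite !ffunE.
have [sS|] := boolP (source a \in S); last by rewrite limg0 sub0v !andbF.
have [tS|] := boolP (target a \in S); first by rewrite subvf implybT.
rewrite (subsetP SP)// andbT subv0 implybF negb_and negbK.
case: eqP => //= nz; symmetry; apply/negbTE; rewrite negbK inE.
apply: contra_notN nz => /eqP M0; apply/eqP.
by rewrite -subv0 -M0 subvf.
Qed.

Lemma signed_sum_submodules :
  \sum_(L <- submodules) (-1) ^+ height L =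
  signed_sum (fun a => rep_map M a @: fullv != 0)%VS support predT.
Proof.
(* The sign depends only on the underlying family of subspaces, so the sum can be moved from
   submodules to vertex sets. *)
pose h (A : {dffun forall j : vertex Q, {vspace M j}}) : int :=
  (-1) ^+ (\sum_j \dim (A j))%N.
rewrite -(big_map val xpredT h) pmap_filter; last exact: insubK.
rewrite big_filter big_map big_enum_cond /=; apply: eq_big => [S|S].
  rewrite inE andbT isSome_insub.
  by have [/stable_spaces_on|] := boolP (S \subset support).
case/andP; rewrite inE => SP _; congr (_ ^+ _).
rewrite -sum1_card [RHS]big_mkcond; apply: eq_bigr => j _.
by rewrite dim_spaces_on//; case: (j \in S).
Qed.

End ThinLattice.

(** * Parity of a signed count, and the conclusion *)

Lemma sum_sign_parity (T : Type) (s : seq T) (h : T -> nat) :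
  exists c : int, \sum_(x <- s) (-1) ^+ h x = (size s)%:Z + c * 2.
Proof.
elim: s => [|x s [c IHs]]; first by exists 0; rewrite big_nil.
rewrite big_cons IHs -signr_odd /=.
by case: (odd (h x)); [exists (c - 1) | exists c]; rewrite /= ?expr0 ?expr1; lia.
Qed.

Theorem theorem1p4 (k : closedFieldType) (n : nat) (Q : quiver)
    (hQ : of_type_A n Q) (M : representation k Q) (hM : indecomposable M) :
  exists lattice : seq (submodule M),
    Finite.axiom lattice /\
    let S : int := \sum_(L <- lattice) (-1) ^+ height L in
    if odd (size lattice) then S = 1 \/ S = -1 else S = 0.
Proof.
have [f [g [f_bij g_bij fg]]] := hQ.
pose r (x : vertex Q) : nat := f x.
have r_inj : injective r by move=> x y /val_inj/(bij_inj f_bij).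
have r_arrow a : r (source a) = (r (target a)).+1 \/ r (target a) = (r (source a)).+1.
  by rewrite /r; case: (fg a) => -[-> ->]; [right | left].
(* The ends of [a] are at positions [g a] and [g a + 1], so the sum is [2 * g a + 1] and determines
   [a]. *)
have r_arrow_inj : injective (fun a : arrow Q => r (source a) + r (target a))%N.
  move=> a b /= eq_ab; apply: (bij_inj g_bij); apply: val_inj => /=.
  by move: eq_ab; rewrite /r; case: (fg a) => -[-> ->]; case: (fg b) => -[-> ->]; lia.
have thin := indecomposable_thin r_inj r_arrow r_arrow_inj hM.
exists (submodules M); split; first exact: submodulesP.
have [c parity] := sum_sign_parity (submodules M) (@height k Q M).
move: parity; rewrite (signed_sum_submodules thin) => parity.
have [bound _] := signed_sum_bounded r_inj r_arrow r_arrow_inj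
  (fun a => rep_map M a @: fullv != 0)%VS (support M).
move=> S; rewrite -/S in parity bound.
(* [S] lies between -1 and 1 and has the parity of the number of submodules, which leaves only the
   claimed values. *)
have := odd_double_half (size (submodules M)).
by case: odd => /=; lia.
Qed.
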